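(* Let $\vec G=(V,\vec E)$ be a finite directed graph, let $d\in\mathbb{Z}^V\setminus\{0\}$ and let $u,l\in\mathbb{Z}^{\vec E}$. Let $F=F_{\vec G,d,u,l}$ be the associated flow polytope. Then the toric ideal $I_F$ is generated in degree three, i.e. $I_F$ has a generating set consisting of polynomials of degree at most $3$.
   Context: Flow polytope: for a finite directed graph $\vec G=(V,\vec E)$, $\vec E\subseteq V\times V$, a demand vector $d\in\mathbb{Z}^V\setminus\{0\}$, and upper and lower bounds $u,l\in\mathbb{Z}^{\vec E}$, $$F_{\vec G,d,u,l}=\Big\{f:\vec E\to\mathbb{R}_{\ge 0}\ \Big|\ \sum_{e \text{ entering } v}f(e)-\sum_{e\text{ leaving }v}f(e)=d_v\ \ \forall v\in V,\ \ l_e\le f(e)\le u_e\ \ \forall e\in\vec E\Big\}\subseteq\mathbb{R}^{\vec E}.$$ It is a lattice polytope. Toric ideal: let $k$ be a field. For a lattice polytope $P\subseteq\mathbb{R}^N$ put $\mathcal{A}=P\cap\mathbb{Z}^N$. The toric ideal $I_P=I_{\mathcal A}$ is the kernel of the $k$-algebra homomorphism $k[x_a : a\in\mathcal{A}]\to k[t_1^{\pm1},\dots,t_N^{\pm1}]$, $x_a\mapsto t^a$. An ideal is ''generated in degree $q$'' if it has a generating set all of whose elements have degree at most $q$ (all variables have degree $1$). *)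

(* Defs.v *)
From HB Require Import structures.
From mathcomp Require Import all_boot all_order all_algebra.
From mathcomp Require Import finmap.
From mathcomp Require Import boolp classical_sets reals.
From mathcomp.multinomials Require Import monalg.

Set Implicit Arguments.
Unset Strict Implicit.
Unset Printing Implicit Defensive.

Import Order.TTheory GRing.Theory Num.Theory.
Local Open Scope fset_scope.
Local Open Scope ring_scope.

(* The Laurent polynomial ring k[t_i, t_i^-1 : i in I]: the group algebra of   *)
(* the additive group Z^I.  The product of {malg k[M]} is not available here,  *)
(* since a monomType has no invertible monomials besides 1.                    *)
Definition laurent (k : comNzRingType) (I : finType) : Type :=
  {malg k[{ffun I -> int}]}.

HB.instance Definition _ (k : comNzRingType) (I : finType) :=
  GRing.Lmodule.on (laurent k I).

Section LaurentRing.
Context (k : comNzRingType) (I : finType).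
Local Notation K := {ffun I -> int}.
Implicit Types (g : {malg k[K]}).

Definition lmonom (a : K) : laurent k I := mkmalgU a 1.

Definition lmul g1 g2 : {malg k[K]} :=
  \sum_(a <- msupp g1) \sum_(b <- msupp g2) mkmalgU (a + b) (g1@_a * g2@_b).

Lemma lmulw (d1 d2 : {fset K}) g1 g2 :
  msupp g1 `<=` d1 -> msupp g2 `<=` d2 ->
  lmul g1 g2 =
    \sum_(a <- d1) \sum_(b <- d2) mkmalgU (a + b) (g1@_a * g2@_b).
Proof.
move=> le1 le2; rewrite /lmul (big_fset_incl _ le1) /=.
  apply/eq_bigr=> a _; apply/big_fset_incl => // b _ /mcoeff_outdom ->.
  by rewrite mulr0 monalgU0.
move=> a _ /mcoeff_outdom g1a.
by rewrite big1 => // b _; rewrite g1a mul0r monalgU0.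
Qed.

Lemma lmulUU (c1 c2 : k) (a b : K) :
  lmul (mkmalgU a c1) (mkmalgU b c2) = mkmalgU (a + b) (c1 * c2).
Proof. by rewrite (lmulw msuppU_le msuppU_le) !big_seq_fset1 !mcoeffUU. Qed.

Lemma lmulC : commutative lmul.
Proof.
move=> g1 g2; rewrite /lmul exchange_big /=.
by apply/eq_bigr=> a _; apply/eq_bigr=> b _; rewrite addrC mulrC.
Qed.

Lemma lmul0 : left_zero 0 lmul.
Proof. by move=> g; rewrite /lmul msupp0 big_seq_fset0. Qed.

Lemma lmulDl : left_distributive lmul +%R.
Proof.
move=> g1 g2 g.
rewrite (lmulw (msuppD_le g1 g2) (fsubset_refl _)).
rewrite (lmulw (fsubsetUl (msupp g1) (msupp g2)) (fsubset_refl _)).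
rewrite (lmulw (fsubsetUr (msupp g1) (msupp g2)) (fsubset_refl _)).
rewrite -big_split /=; apply/eq_bigr=> a _.
rewrite -big_split /=; apply/eq_bigr=> b _.
by rewrite mcoeffD mulrDl monalgUD.
Qed.

Lemma lmul_suml (J : Type) (r : seq J) (F : J -> {malg k[K]}) g :
  lmul (\sum_(j <- r) F j) g = \sum_(j <- r) lmul (F j) g.
Proof.
exact: (big_morph (lmul^~ g) (fun x y => lmulDl x y g) (lmul0 g)).
Qed.

Lemma lmul_sumr (J : Type) (r : seq J) (F : J -> {malg k[K]}) g :
  lmul g (\sum_(j <- r) F j) = \sum_(j <- r) lmul g (F j).
Proof.
by rewrite lmulC lmul_suml; apply/eq_bigr=> j _; rewrite lmulC.
Qed.

Lemma lmulA : associative lmul.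
Proof.
move=> g1 g2 g3; rewrite (monalgE g1) (monalgE g2) (monalgE g3).
rewrite !lmul_suml; apply/eq_bigr=> a _.
rewrite !(lmul_sumr _ _ (mkmalgU a _)) lmul_suml; apply/eq_bigr=> b _.
rewrite !lmul_sumr; apply/eq_bigr=> c _.
by rewrite !lmulUU addrA mulrA.
Qed.

Lemma lmul1 : left_id (lmonom 0) lmul.
Proof.
move=> g; rewrite [in LHS](monalgE g) lmul_sumr [RHS]monalgE.
by apply/eq_bigr=> a _; rewrite lmulUU add0r mul1r.
Qed.

Lemma lone_neq0 : lmonom 0 != 0.
Proof. by rewrite monalgU_eq0 oner_eq0. Qed.

HB.instance Definition _ := GRing.Zmodule_isComNzRing.Build (laurent k I)
  lmulA lmulC lmul1 lmulDl lone_neq0.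

Lemma lscaleAl (c : k) (g1 g2 : laurent k I) : c *: (g1 * g2) = c *: g1 * g2.
Proof.
rewrite [RHS](lmulw (msuppZ_le c g1) (fsubset_refl _)) /=.
rewrite {1}[g1 * g2]/(lmul g1 g2) /lmul scaler_sumr.
apply/eq_bigr=> a _; rewrite scaler_sumr; apply/eq_bigr=> b _.
by apply/malgP=> x; rewrite mcoeffZ !mcoeffU mcoeffZ mulrnAr mulrA.
Qed.

HB.instance Definition _ :=
  GRing.Lmodule_isLalgebra.Build k (laurent k I) lscaleAl.
HB.instance Definition _ :=
  GRing.Lalgebra_isComAlgebra.Build k (laurent k I).

Lemma lmonomD a b : lmonom (a + b) = lmonom a * lmonom b.
Proof. by rewrite [RHS]lmulUU mulr1. Qed.

End LaurentRing.

Local Open Scope classical_set_scope.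

Section ToricIdeal.
Context (R : realType) (I : finType).

Definition lattice_points (P : set {ffun I -> R}) : set {ffun I -> int} :=
  [set a : {ffun I -> int} | P [ffun i => (a i)%:~R]].

Context (k : fieldType) (A : set {ffun I -> int}).

Definition toric_monom (m : {cmonom A}) : laurent k I :=
  \prod_(a <- finsupp m) lmonom k (val a) ^+ m a.

Fact toric_monom_is_mmorphism : mmorphism toric_monom.
Proof.
split=> [m1 m2|]; last by rewrite /toric_monom mdom1 big_seq_fset0.
have w (m : {cmonom A}) (d : {fset A}) : (finsupp m `<=` d)%fset ->
    toric_monom m = \prod_(a <- d) lmonom k (val a) ^+ m a.
  move=> le; rewrite /toric_monom (big_fset_incl _ le) // => a _.
  by rewrite -cmE_neq0 negbK => /eqP ->; rewrite expr0.
rewrite (w _ _ (fsubset_refl _)) mdomD.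
rewrite (w _ _ (fsubsetUl (finsupp m1) (finsupp m2))).
rewrite (w _ _ (fsubsetUr (finsupp m1) (finsupp m2))).
by rewrite -big_split /=; apply/eq_bigr=> a _; rewrite cmM exprD.
Qed.

HB.instance Definition _ :=
  isMultiplicative.Build _ _ toric_monom toric_monom_is_mmorphism.

(* Polynomials in variables x_a, a in A, are {malg k[{cmonom A}]}; A need not  *)
(* be known to be finite.                                                      *)
Definition toric_hom : {rmorphism {malg k[{cmonom A}]} -> laurent k I} :=
  mmap (in_alg (laurent k I)) toric_monom.

Lemma toric_homX (a : A) : toric_hom (mkmalgU (ucm a) 1) = lmonom k (val a).
Proof.
by rewrite /= mmapU /= scale1r mul1r /toric_monom mdomU big_seq_fset1 cmUU.
Qed.

Lemma toric_homZ (c : k) p : toric_hom (c *: p) = c *: toric_hom p.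
Proof. by rewrite /= mmapZ /= mulr_algl. Qed.

End ToricIdeal.

Definition toric_ideal (R : realType) (I : finType) (k : fieldType)
    (P : set {ffun I -> R}) : set {malg k[{cmonom (lattice_points P)}]} :=
  [set p | toric_hom k (lattice_points P) p = 0].
Arguments toric_ideal {R I} k P.

Definition ideal_span (S : comNzRingType) (G : set S) : set S :=
  [set p | exists (n : nat) (h g : 'I_n -> S),
     (forall i, G (g i)) /\ p = \sum_(i < n) h i * g i].

(* msize is the total degree plus one, and msize 0 = 0.                        *)
Definition generated_in_degree (q : nat) (X : choiceType) (k : fieldType)
    (J : set {malg k[{cmonom X}]}) : Prop :=
  exists G : set {malg k[{cmonom X}]},
    (forall g, G g -> (msize g <= q.+1)%N) /\ J = ideal_span G.

(* The arc (v, w) leaves v and enters w. *)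
Definition flow_polytope (R : realType) (V : finType) (E : {set V * V})
    (d : {ffun V -> int}) (u l : {ffun {e | e \in E} -> int}) :
    set {ffun {e | e \in E} -> R} :=
  [set f : {ffun {e | e \in E} -> R} | [/\ forall e, 0 <= f e,
      forall v, \sum_(e | (val e).2 == v) f e - \sum_(e | (val e).1 == v) f e
                = (d v)%:~R
    & forall e, (l e)%:~R <= f e <= (u e)%:~R]].
Arguments flow_polytope R {V E} d u l.

(* Main.v *)
Require Import Defs.
From mathcomp Require Import all_boot all_order all_algebra.
From mathcomp Require Import finmap boolp classical_sets reals.
From mathcomp.multinomials Require Import monalg.
From mathcomp Require Import zify ring.
Set Implicit Arguments.
Unset Strict Implicit.
Unset Printing Implicit Defensive.
Import Order.TTheory GRing.Theory Num.Theory.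
Local Open Scope ring_scope.

(* The toric ideal is spanned by the binomials x^s - x^t, where s and t are   *)
(* multisets of integer flows with equal sum; equal sums have equal size      *)
(* because d <> 0.  So any two such multisets have to be linked by moves that *)
(* each replace at most three flows.  It suffices to reach from s a multiset  *)
(* containing a given g in t, and to induct.  Start from two members p and q  *)
(* of s and let p walk to g, changing one arc at a time along directed paths  *)
(* of the residual digraph of g - p.  Meanwhile p violates the demands by a   *)
(* unit flow from a to b, and q by the opposite one; whenever q is blocked by *)
(* a bound on the next arc, a cycle is pushed from q to another member h that *)
(* is not.  Every intermediate p + q is again a sum of two flows, by pushing  *)
(* back a path of p - q from a to b, so each step is a move on the two flows  *)
(* splitting p + q and on h.  Paths and cycles exist by counting the netflow  *)
(* of the set of vertices reachable in the residual digraph.                  *)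

Section IdealSpan.
Context (S : comNzRingType) (G : set S).

Lemma ideal_span_gen g : G g -> ideal_span G g.
Proof.
move=> Gg; exists 1, (fun=> 1), (fun=> g); split=> //.
by rewrite big_ord1 mul1r.
Qed.

Lemma ideal_span0 : ideal_span G 0.
Proof.
by exists 0, (fun=> 0), (fun=> 0); split=> [[]//|]; rewrite big_ord0.
Qed.

Lemma ideal_spanD p q :
  ideal_span G p -> ideal_span G q -> ideal_span G (p + q).
Proof.
move=> [n [h [g [Gg ->]]]] [n' [h' [g' [Gg' ->]]]].
pose glue (f : 'I_n -> S) (f' : 'I_n' -> S) i :=
  match split i with inl j => f j | inr j => f' j end.
exists (n + n'), (glue h h'), (glue g g'); split.
  by move=> i; rewrite /glue; case: split.
rewrite big_split_ord /glue /=; congr (_ + _); apply: eq_bigr => i _.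
  by rewrite (unsplitK (inl i)).
by rewrite (unsplitK (inr i)).
Qed.

Lemma ideal_spanM c p : ideal_span G p -> ideal_span G (c * p).
Proof.
move=> [n [h [g [Gg ->]]]]; exists n, (fun i => c * h i), g; split=> //.
by rewrite mulr_sumr; apply: eq_bigr => i _; rewrite mulrA.
Qed.

Lemma ideal_span_mulB a a' b b' :
  ideal_span G (a - a') -> ideal_span G (b - b') ->
  ideal_span G (a * b - a' * b').
Proof.
move=> /(ideal_spanM b) aa' /(ideal_spanM a') /(ideal_spanD aa').
by congr (ideal_span _ _); ring.
Qed.

Lemma ideal_span_sum (J : Type) (r : seq J) (F : J -> S) :
  (forall j, ideal_span G (F j)) -> ideal_span G (\sum_(j <- r) F j).
Proof.
move=> GF; elim/big_rec: _ => [|j p _]; first exact: ideal_span0.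
exact: ideal_spanD.
Qed.

End IdealSpan.

Section Monomials.
Context (X : choiceType) (k : fieldType).
Implicit Types (m : {cmonom X}) (s : seq X).

Definition monom_of s : {cmonom X} := \big[mmul/mone]_(a <- s) ucm a.

Lemma monom_ofP m : exists s, m = monom_of s.
Proof.
have [n] := ubnP (mdeg m); elim: n m => // n IHn m mn.
have [/eqP m0|] := boolP (mdeg m == 0)%N.
  by exists [::]; rewrite /monom_of big_nil; apply: mdeg_eq0I.
rewrite mdegE; have [->|[a am]] := fset_0Vmem (finsupp m).
  by rewrite big_seq_fset0.
move=> _.
have mE : m = mmul (ucm a) (divcm m (ucm a)).
  apply/eqP/cmP => i; rewrite cmM divcmE cmU; case: eqP => [<-|_]; last first.
    by rewrite subn0.
  by rewrite subnKC // lt0n cmE_neq0.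
have [|s sE] := IHn (divcm m (ucm a)).
  by move: mn; rewrite {1}mE mdegM mdegU.
by exists (a :: s); rewrite /monom_of big_cons mE {1}sE.
Qed.

Lemma mdeg_monom_of s : mdeg (monom_of s) = size s.
Proof.
rewrite /monom_of mdeg_prod; under eq_bigr do rewrite mdegU.
by rewrite sum1_size.
Qed.

Lemma malg_termE (c : k) m :
  mkmalgU m c = malgC c * mkmalgU m 1 :> {malg k[{cmonom X}]}.
Proof. by rewrite malgM_def fgmulUU mul1m mulr1. Qed.

Lemma msize_binomial q m m' : (mdeg m <= q)%N -> (mdeg m' <= q)%N ->
  (msize (mkmalgU m 1 - mkmalgU m' 1 : {malg k[{cmonom X}]}) <= q.+1)%N.
Proof.
move=> mq m'q; rewrite msizeE big_seq.
elim/big_ind: _ => // [a b aq bq|n]; first by rewrite geq_max aq.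
move=> /(fsubsetP (msuppB_le _ _)); rewrite in_fsetU.
by case/orP=> /(fsubsetP msuppU_le); rewrite in_fset1 => /eqP->.
Qed.

Lemma malgUM m m' :
  mkmalgU m 1 * mkmalgU m' 1 = mkmalgU (mmul m m') 1 :> {malg k[{cmonom X}]}.
Proof. by rewrite malgM_def fgmulUU mulr1. Qed.

Lemma monom_of_cat s s' :
  monom_of (s ++ s') = mmul (monom_of s) (monom_of s').
Proof. exact: big_cat. Qed.

Lemma perm_monom_of s s' : perm_eq s s' -> monom_of s = monom_of s'.
Proof. exact: perm_big. Qed.

End Monomials.

Section Binomials.
Context (k : fieldType) (I : finType) (A : set {ffun I -> int}).
Implicit Types (m : {cmonom A}) (s t : seq A).

Lemma lmonomMn (a : {ffun I -> int}) n : lmonom k (a *+ n) = lmonom k a ^+ n.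
Proof.
by elim: n => [|n IHn]; rewrite ?mulr0n // mulrSr exprSr lmonomD IHn.
Qed.

Definition weight m : {ffun I -> int} := \sum_(a <- finsupp m) val a *+ m a.

Lemma toric_monomE m : toric_monom k m = lmonom k (weight m).
Proof.
rewrite /toric_monom; under eq_bigr do rewrite -lmonomMn.
by apply/esym/big_morph => //; apply: lmonomD.
Qed.

Lemma weightM m m' : weight (mmul m m') = weight m + weight m'.
Proof.
have w (n : {cmonom A}) (D : {fset A}) : (finsupp n `<=` D)%fset ->
    weight n = \sum_(a <- D) val a *+ n a.
  move=> le; rewrite /weight (big_fset_incl _ le) // => a _.
  by rewrite -cmE_neq0 negbK => /eqP->.
rewrite (w _ _ (fsubset_refl _)) mdomD.
rewrite (w m _ (fsubsetUl _ (finsupp m'))) (w m' _ (fsubsetUr (finsupp m) _)).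
by rewrite -big_split; apply: eq_bigr => a _; rewrite cmM mulrnDr.
Qed.

Lemma weight_monom_of s : weight (monom_of s) = \sum_(a <- s) val a.
Proof.
elim: s => [|a s IHs].
  by rewrite /monom_of !big_nil /weight mdom1 big_seq_fset0.
rewrite /monom_of !big_cons weightM -IHs; congr (_ + _).
by rewrite /weight mdomU big_seq_fset1 cmUU.
Qed.

Lemma lmonomZ c (a : {ffun I -> int}) : c *: lmonom k a = mkmalgU a c.
Proof.
by apply/malgP => b; rewrite mcoeffZ !mcoeffU mulrnAr mulr1.
Qed.

Lemma toric_homE p : toric_hom k A p =
  \sum_(m <- msupp p) (mkmalgU (weight m) p@_m : laurent k I).
Proof.
rewrite [LHS]mmapE; apply: eq_bigr => m _.
by rewrite /= toric_monomE mulr_algl lmonomZ.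
Qed.

Lemma toric_homU m : toric_hom k A (mkmalgU m 1) = lmonom k (weight m).
Proof. by rewrite [LHS]mmapU /= toric_monomE mulr_algl scale1r. Qed.

Lemma toric_hom_binomial m m' : weight m = weight m' ->
  toric_hom k A (mkmalgU m 1 - mkmalgU m' 1) = 0.
Proof.
move=> mm'; apply: etrans (rmorphB _ _ _) _.
apply/eqP; rewrite subr_eq0; apply/eqP.
apply: etrans (toric_homU m) _.
rewrite mm'; exact/esym/toric_homU.
Qed.

(* The toric ideal is spanned by binomials of equal weight: replacing each    *)
(* monomial by a representative of its weight turns a polynomial of the ideal *)
(* into zero, since that substitution factors through [toric_hom].            *)
Lemma toric_binomials (G : set {malg k[{cmonom A}]}) p :
  (forall m m', weight m = weight m' ->
     ideal_span G (mkmalgU m 1 - mkmalgU m' 1)) ->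
  toric_hom k A p = 0 -> ideal_span G p.
Proof.
move=> Gbin p0.
pose rep w : {cmonom A} := xget mone [set m | weight m = w].
have weight_rep m : weight (rep (weight m)) = weight m.
  rewrite /rep; case: xgetP => [_ _ //|/(_ m)]; by case.
pose psi : {malg k[{ffun I -> int}]} -> {malg k[{cmonom A}]} :=
  mmap (@malgC {cmonom A} k) (fun w => mkmalgU (rep w) 1).
have psi0 : \sum_(m <- msupp p) malgC p@_m * mkmalgU (rep (weight m)) 1 = 0
    :> {malg k[{cmonom A}]}.
  have := congr1 psi p0; rewrite /psi mmap0 toric_homE raddf_sum /= => sum0.
  rewrite -[RHS]sum0; apply: eq_bigr => m _.
  by rewrite mmapU.
rewrite -[p]subr0 -psi0 [X in X - _]monalgE -sumrB.
apply: ideal_span_sum => m.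
have -> : mkmalgU m p@_m = malgC p@_m * mkmalgU m 1 :> {malg k[{cmonom A}]}.
  exact: malg_termE.
by rewrite -mulrBr; apply/ideal_spanM/Gbin; rewrite weight_rep.
Qed.

End Binomials.

(** * Decompositions into integer flows *)

Section Netflow.
Context (V A : finType) (src dst : A -> V).
Implicit Types (f g h p q x y z : {ffun A -> int}) (v w a b : V) (W : {set V}).
Implicit Types (D : A * bool) (e : A) (s t r : seq {ffun A -> int}).

Definition netflow x v : int :=
  \sum_e x e * ((dst e == v)%:R - (src e == v)%:R).

Definition tail D := if D.2 then dst D.1 else src D.1.
Definition head D := if D.2 then src D.1 else dst D.1.
Definition sign D : int := if D.2 then -1 else 1.
Definition unitv D : {ffun A -> int} := [ffun e => sign D *+ (e == D.1)].
Definition flip D := (D.1, ~~ D.2).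

(* Used instead of [ffunE], which leaves unreduced structure projections in   *)
(* the types of [x e] and [y e], so that [lia] and [ring] see distinct atoms. *)
Lemma addvE x y e : (x + y) e = x e + y e. Proof. exact: ffunE. Qed.
Lemma oppvE x e : (- x) e = - x e. Proof. exact: ffunE. Qed.
Lemma zerovE e : (0 : {ffun A -> int}) e = 0. Proof. exact: ffunE. Qed.
Lemma unitvE D e : unitv D e = sign D *+ (e == D.1). Proof. exact: ffunE. Qed.
Definition vE := (addvE, oppvE, zerovE, unitvE).

(* [D] is an arc of the residual digraph of the signed vector [x]: an arc of *)
(* negative value is traversed backwards.                                    *)
Definition along x D := 0 < sign D * x D.1.
Definition residual x : rel V :=
  fun v w => [exists D, [&& along x D, tail D == v & head D == w]].

Lemma netflowE x v :
  netflow x v = \sum_(e | dst e == v) x e - \sum_(e | src e == v) x e.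
Proof.
rewrite /netflow; under eq_bigr do rewrite mulrBr !mulr_natr !mulrb.
by rewrite sumrB -!big_mkcond.
Qed.

Lemma netflowD x y v : netflow (x + y) v = netflow x v + netflow y v.
Proof. by rewrite -big_split; apply: eq_bigr => e _; rewrite vE mulrDl. Qed.

Lemma netflowN x v : netflow (- x) v = - netflow x v.
Proof. by rewrite -sumrN; apply: eq_bigr => e _; rewrite vE mulNr. Qed.

Lemma netflow0 v : netflow 0 v = 0.
Proof. by apply: big1 => e _; rewrite vE mul0r. Qed.

Lemma netflow_unitv D v :
  netflow (unitv D) v = (head D == v)%:R - (tail D == v)%:R.
Proof.
rewrite /netflow (bigD1 D.1) //= big1 => [|e /negPf eD].
  rewrite vE eqxx mulr1n addr0 /sign /head /tail.
  by case: D.2; ring.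
by rewrite vE eD mul0r.
Qed.

Definition netflowS := (netflow_unitv, netflowD, netflowN, netflow0).

Lemma sum_delta a W : \sum_(v in W) ((a == v)%:R : int) = (a \in W)%:R.
Proof.
rewrite big_mkcond (bigD1 a) //= eqxx big1 => [|v /negPf av].
  by rewrite addr0; case: ifP.
by rewrite eq_sym av if_same.
Qed.

Lemma sum_netflow x W :
  \sum_(v in W) netflow x v =
    \sum_e x e * ((dst e \in W)%:R - (src e \in W)%:R).
Proof.
rewrite exchange_big; apply: eq_bigr => e _.
by rewrite -mulr_sumr sumrB !sum_delta.
Qed.

Lemma closed_term_ge0 x W :
  (forall D, along x D -> tail D \in W -> head D \in W) ->
  forall e, 0 <= x e * ((dst e \in W)%:R - (src e \in W)%:R).
Proof.
move=> clW e.
move: (clW (e, false)) (clW (e, true)); rewrite /along /tail /head /sign /=.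
case: (dst e \in W) (src e \in W) => [] [] /= h1 h2; lia.
Qed.

Lemma closed_netflow_ge0 x W :
  (forall D, along x D -> tail D \in W -> head D \in W) ->
  0 <= \sum_(v in W) netflow x v.
Proof.
by move=> clW; rewrite sum_netflow sumr_ge0 // => e _; apply: closed_term_ge0.
Qed.

Lemma closed_netflow_gt0 x W D :
  (forall D, along x D -> tail D \in W -> head D \in W) ->
  along x D -> tail D \notin W -> head D \in W ->
  0 < \sum_(v in W) netflow x v.
Proof.
move=> clW xD tD hD; rewrite sum_netflow (bigD1 D.1) //=.
rewrite ltr_pwDl ?sumr_ge0 // => [|e _]; last exact: closed_term_ge0.
move: xD tD hD; rewrite /along /tail /head /sign.
by case: D.2 => xD /negPf -> ->; lia.
Qed.

Lemma reach_closed x a D :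
  along x D -> tail D \in [set v | connect (residual x) a v] ->
  head D \in [set v | connect (residual x) a v].
Proof.
move=> xD; rewrite !inE => /connect_trans; apply; apply: connect1.
by apply/existsP; exists D; rewrite xD !eqxx.
Qed.

Definition conformal z x := forall e, (0 <= z e <= x e) || (x e <= z e <= 0).

Lemma path_conformal x a (p : seq V) :
    path (residual x) a p -> uniq (a :: p) ->
  exists z, [/\ conformal z x,
    forall v, netflow z v = (last a p == v)%:R - (a == v)%:R
    & forall D, along x D -> tail D \notin belast a p -> z D.1 = 0].
Proof.
elim: p a => [|b p IHp] a /=.
  move=> _ _; exists 0; split=> [e|v|D _ _]; last by rewrite vE.
    by rewrite vE lexx /=; case: ltrgtP.
  by rewrite netflow0 subrr.
case/andP=> /existsP[D /and3P[xD /eqP tD /eqP hD]] xp /andP[abp up].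
have [z [cz nz sz]] := IHp _ xp up.
have aNb : a \notin belast b p.
  by apply: contra abp => /mem_belast; rewrite inE.
exists (z + unitv D); split.
- move=> e; rewrite !vE; case: eqP => [->|_]; last first.
    by rewrite mulr0n addr0; apply: cz.
  rewrite (sz D) ?tD // add0r mulr1n.
  by move: xD; rewrite /along /sign; case: D.2; lia.
- by move=> v; rewrite !netflowS nz tD hD; ring.
- move=> D' xD'; rewrite inE negb_or => /andP[tD' D'p].
  rewrite !vE (sz D') // add0r; case: eqP => // DD'.
  case/eqP: tD'; rewrite -tD; move: xD xD' DD'; rewrite /along /tail /sign.
  case: (D) (D') => [e []] [e' []] /= h h' ee'; subst=> //; exfalso; lia.
Qed.

Lemma connect_conformal x a b : connect (residual x) a b ->
  exists z, [/\ conformal z x,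
    forall v, netflow z v = (b == v)%:R - (a == v)%:R
    & forall D, along x D -> tail D = b -> z D.1 = 0].
Proof.
case/connectP=> p0 /shortenP[p xp up _] ->.
have [z [cz nz sz]] := path_conformal xp up.
exists z; split=> // D xD tD; apply: sz => //; rewrite tD.
by move: up; rewrite lastI rcons_uniq => /andP[].
Qed.


Context (lo hi : A -> int) (d : V -> int).

Definition box x := forall e, lo e <= x e <= hi e.
Definition flow x := box x /\ forall v, netflow x v = d v.
Definition total (s : seq {ffun A -> int}) : {ffun A -> int} := \sum_(x <- s) x.

(* [x - unitv D] stays within the bound that [D] moves it towards. *)
Definition room x D := if D.2 then x D.1 < hi D.1 else lo D.1 < x D.1.

Lemma total_cons x s : total (x :: s) = x + total s.
Proof. exact: big_cons. Qed.

Lemma total_perm s t : perm_eq s t -> total s = total t.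
Proof. exact: perm_big. Qed.

Lemma conformal_box x y z :
  box x -> box y -> conformal z (x - y) -> box (x - z) /\ box (y + z).
Proof.
move=> bx byy cz.
suff h e : (lo e <= x e - z e <= hi e) && (lo e <= y e + z e <= hi e).
  by split=> e; move: (h e); rewrite !vE => /andP[].
by move: (bx e) (byy e) (cz e); rewrite !vE; lia.
Qed.

Lemma resolve p q a b :
  box p -> box q ->
  (forall v, netflow p v = d v + (b == v)%:R - (a == v)%:R) ->
  (forall v, netflow q v = d v - (b == v)%:R + (a == v)%:R) ->
  exists f f', [/\ flow f, flow f' & f + f' = p + q].
Proof.
move=> bp bq np nq.
have ab : connect (residual (p - q)) a b.
  set W := [set v | connect (residual (p - q)) a v].
  have /closed_netflow_ge0 : forall D, along (p - q) D ->
    tail D \in W -> head D \in W by move=> D; apply: reach_closed.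
  under eq_bigr => v _.
    rewrite (_ : netflow _ v = (b == v)%:R + (b == v)%:R
                             - ((a == v)%:R + (a == v)%:R)).
      over.
    by rewrite !netflowS np nq; ring.
  rewrite sumrB !big_split /= !sum_delta !inE connect0.
  by case: connect.
have [z [/(conformal_box bp bq)[bpz bqz] nz _]] := connect_conformal ab.
exists (p - z), (q + z); split; try split=> // v; rewrite ?netflowS.
- by rewrite np nz; ring.
- by rewrite nq nz; ring.
- by rewrite addrACA addNr addr0.
Qed.

Lemma next_arc g p a b : g != p ->
  (forall v, netflow g v = d v) ->
  (forall v, netflow p v = d v + (b == v)%:R - (a == v)%:R) ->
  exists c D, along (g - p) D /\
    forall v, (tail D == v)%:R - (c == v)%:R = (b == v)%:R - (a == v)%:R :> int.
Proof.
move=> gp ng np; have [eab|aNb] := eqVneq a b.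
  have [e ge] : exists e, g e != p e.
    apply/existsP; apply: contraNT gp; rewrite negb_exists => /forallP h.
    by apply/eqP/ffunP => e; move: (h e); rewrite negbK => /eqP.
  exists (tail (e, g e < p e)), (e, g e < p e); split; last first.
    by move=> v; rewrite eab !subrr.
  rewrite /along /sign !vE /=; move: ge.
  by case: (boolP (g e < p e)) => /=; lia.
have [/existsP[D /andP[xD /eqP tD]]|none] :=
    boolP [exists D, along (g - p) D && (tail D == b)].
  by exists a, D; split=> // v; rewrite tD.
have /closed_netflow_ge0 : forall D, along (g - p) D ->
    tail D \in [set b] -> head D \in [set b].
  move=> D xD; rewrite inE => tD; case/existsP: none; exists D.
  by rewrite xD tD.
by rewrite big_set1 !netflowS ng np eqxx (negPf aNb); lia.
Qed.

Lemma total_le s e c : (forall x, x \in s -> x e <= c) ->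
  total s e <= (size s)%:Z * c.
Proof.
elim: s => [|x s IHs] h; first by rewrite /total big_nil vE mul0r.
rewrite total_cons vE /= intS mulrDl mul1r lerD ?IHs ?h ?mem_head //.
by move=> y ys; rewrite h // inE ys orbT.
Qed.

Lemma total_ge s e c : (forall x, x \in s -> c <= x e) ->
  (size s)%:Z * c <= total s e.
Proof.
elim: s => [|x s IHs] h; first by rewrite /total big_nil vE mul0r.
rewrite total_cons vE /= intS mulrDl mul1r lerD ?IHs ?h ?mem_head //.
by move=> y ys; rewrite h // inE ys orbT.
Qed.

Lemma exists_room g p s D : along (g - p) D ->
  (forall e, (size s)%:Z * lo e <= (p + total s - g) e
               <= (size s)%:Z * hi e) ->
  exists2 x, x \in s & room x D.
Proof.
case: D => e r xD bs; apply/hasP; apply: contraT => /hasPn none.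
move: (bs e) xD none; rewrite /along /sign /room !vE /=.
case: r => /andP[h1 h2] xD none.
  have : (size s)%:Z * hi e <= total s e.
    by apply: total_ge => x /none; rewrite -leNgt.
  lia.
have : total s e <= (size s)%:Z * lo e.
  by apply: total_le => x /none; rewrite -leNgt.
lia.
Qed.

Lemma distance_unitv g p D : along (g - p) D ->
  \sum_e `|(g - (p + unitv D)) e| + 1 = \sum_e `|(g - p) e|.
Proof.
move=> xD; rewrite (bigD1 D.1) // [RHS](bigD1 D.1) //= addrAC; congr (_ + _).
  by move: xD; rewrite /along !vE eqxx mulr1n /sign; case: D.2; lia.
by apply: eq_bigr => e /negPf eD; rewrite !vE eD mulr0n addr0.
Qed.

Lemma step_box g p D : box g -> box p -> along (g - p) D -> box (p + unitv D).
Proof.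
move=> bg bp xD e; move: xD (bg e) (bp e); rewrite /along !vE /sign.
by case: eqP => [->|_]; rewrite ?mulr1n ?mulr0n; case: D.2; lia.
Qed.

Lemma room_box x D : box x -> room x D -> box (x - unitv D).
Proof.
move=> bx xD e; move: xD (bx e); rewrite /room !vE /sign.
by case: eqP => [->|_]; rewrite ?mulr1n ?mulr0n; case: D.2; lia.
Qed.

(* [q] cannot absorb [- unitv D] but the flow [h] can: then [q - h] carries a *)
(* cycle [z - unitv D] through the reversal of [D], and pushing it from [q]   *)
(* to [h] makes room in [q].                                                  *)
Lemma reroute q h a D :
  box q -> flow h -> ~~ room q D -> room h D ->
  (forall v, netflow q v = d v - (tail D == v)%:R + (a == v)%:R) ->
  exists z, [/\ box (q - z), flow (h + z - unitv D) &
    forall v, netflow z v = (head D == v)%:R - (tail D == v)%:R].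
Proof.
move=> bq [bh nh] qD hD nq.
have xD : along (q - h) (flip D).
  move: (bq D.1) qD hD; rewrite /room /along /sign /flip !vE /=.
  by case: D.2 => /=; lia.
have tF : tail (flip D) = head D by rewrite /tail /head /=; case: D.2.
have hF : head (flip D) = tail D by rewrite /tail /head /=; case: D.2.
have ab : connect (residual (q - h)) (tail D) (head D).
  set W := [set v | connect (residual (q - h)) (tail D) v].
  have clW : forall D, along (q - h) D -> tail D \in W -> head D \in W.
    by move=> D'; apply: reach_closed.
  apply: contraT => NhW.
  have := closed_netflow_gt0 clW xD; rewrite tF hF !inE NhW connect0.
  move=> /(_ isT isT).
  under eq_bigr => v _.
    rewrite (_ : netflow _ v = (a == v)%:R - (tail D == v)%:R).
      over.
    by rewrite !netflowS nq nh; ring.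
  by rewrite sumrB !sum_delta !inE connect0; case: connect.
have [z [cz nz sz]] := connect_conformal ab.
have [bqz bhz] := conformal_box bq bh cz.
exists z; split=> //; split=> [|v]; last first.
  by rewrite !netflowS nz nh; ring.
have zD : z D.1 = 0 by apply: (sz (flip D)).
apply: room_box => //.
by move: hD; rewrite /room !vE zD addr0.
Qed.

Context (cong : seq {ffun A -> int} -> seq {ffun A -> int} -> Prop).
Context (cong_trans : forall s t r, cong s t -> cong t r -> cong s r).
Context (cong_perm : forall s t, perm_eq s t -> cong s t).
Context (cong_cat : forall s s' t t',
  cong s t -> cong s' t' -> cong (s ++ s') (t ++ t')).
Context (cong_small : forall s t,
  (forall x, x \in s ++ t -> flow x) -> (size s <= 3)%N -> size s = size t ->
  total s = total t -> cong s t).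

Lemma cong_refl s : cong s s. Proof. exact: cong_perm. Qed.

(* [p] walks from a flow to [g], carrying one unit of defect from [a] to [b]; *)
(* [q] carries the opposite defect, and the current decomposition is          *)
(* [f, f' & s], where [f, f'] is any splitting of [p + q] into flows.         *)
Lemma walk n g p q s a b f f' :
  \sum_e `|(g - p) e| < n%:Z -> flow g -> flow f -> flow f' ->
  f + f' = p + q -> box p -> box q ->
  (forall v, netflow p v = d v + (b == v)%:R - (a == v)%:R) ->
  (forall v, netflow q v = d v - (b == v)%:R + (a == v)%:R) ->
  (forall x, x \in s -> flow x) ->
  (forall e, (size s).+1%:Z * lo e <= (p + total (q :: s) - g) e
               <= (size s).+1%:Z * hi e) ->
  exists s', [/\ forall x, x \in s' -> flow x, size s' = (size s).+1,
    g + total s' = f + f' + total s & cong [:: f, f' & s] (g :: s')].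
Proof.
elim: n p q s a b f f' => [|n IHn] p q s a b f f' dist fg ff ff' ffE bp bq
  np nq fs bs.
  by move: dist; rewrite ltNge sumr_ge0.
have [gp|gNp] := eqVneq g p.
  have fq : flow q.
    split=> // v; move: (np v); rewrite -gp (fg.2 v) nq; lia.
  exists (q :: s); split.
  - by move=> x; rewrite inE => /predU1P[->|/fs].
  - by [].
  - by rewrite total_cons ffE gp addrA.
  - apply: (@cong_cat [:: f; f'] s [:: g; q] s); last exact: cong_refl.
    apply: cong_small => //; first by move=> x; rewrite !inE => /or4P[] /eqP->.
    by rewrite !total_cons /total big_nil !addr0 ffE gp.
have [c [D [xD cE]]] := next_arc gNp fg.2 np.
have np' v : netflow (p + unitv D) v = d v + (head D == v)%:R - (c == v)%:R.
  by move: (cE v); rewrite !netflowS np; lia.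
have nq' v : netflow q v = d v - (tail D == v)%:R + (c == v)%:R.
  by move: (cE v); rewrite nq; lia.
have bp' := step_box fg.1 bp xD.
have dist' : \sum_e `|(g - (p + unitv D)) e| < n%:Z.
  by move: dist; rewrite -(distance_unitv xD); lia.
have [qD|NqD] := boolP (room q D).
  apply: (IHn (p + unitv D) (q - unitv D) s c (head D)) => //.
  - by rewrite ffE addrACA subrr addr0.
  - exact: room_box.
  - by move=> v; rewrite !netflowS nq'; ring.
  - move=> e.
    suff -> : p + unitv D + total (q - unitv D :: s) = p + total (q :: s).
      exact: bs.
    by rewrite !total_cons; apply/ffunP => i; rewrite !vE; ring.
have [h] := @exists_room g p (q :: s) D xD bs; rewrite inE => /predU1P[->|].
  by rewrite (negPf NqD).
move=> hs hD; have [z [bqz fh nz]] := reroute bq (fs h hs) NqD hD nq'.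
have nqz v : netflow (q - z) v = d v - (head D == v)%:R + (c == v)%:R.
  by rewrite !netflowS nq' nz; ring.
have [k [k' [fk fk' kE]]] := resolve bp' bqz np' nqz.
set h' := h + z - unitv D in fh.
have [r sE] : exists r, perm_eq s (h :: r).
  by exists (rem h s); apply: perm_to_rem.
have sr : (size s).+1 = (size (h' :: r)).+1 by rewrite (perm_size sE).
have [||s' [fs' ss' ts' cs']] :=
  IHn (p + unitv D) (q - z) (h' :: r) c (head D) k k' dist' fg fk fk' kE bp' bqz
    np' nqz.
- move=> x; rewrite inE => /predU1P[-> //|xr]; apply: fs.
  by rewrite (perm_mem sE) inE xr orbT.
- move=> e.
  suff <- : p + total (q :: s) = p + unitv D + total (q - z :: h' :: r).
    by rewrite -sr.
  rewrite !total_cons (total_perm sE) total_cons /h'.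
  by apply/ffunP => i; rewrite !vE; ring.
have tE : k + k' + h' = f + f' + h.
  by rewrite kE ffE /h'; apply/ffunP => e; rewrite !vE; ring.
clearbody h'.
exists s'; split=> //.
- by rewrite ss' sr.
- by rewrite ts' (total_perm sE) !total_cons !addrA tE.
apply: cong_trans cs'.
apply: (@cong_trans _ ([:: f; f'; h] ++ r)).
  by apply: cong_perm; rewrite /= !perm_cons.
apply: (@cong_cat _ r [:: k; k'; h'] r); last exact: cong_refl.
apply: cong_small => //.
  move=> x; rewrite !inE => /or4P[/eqP->|/eqP->|/eqP->|/or3P[] /eqP->] //.
  exact: fs.
by rewrite !total_cons /total big_nil !addr0 !addrA tE.
Qed.

Lemma cong_total (v0 : V) s t :
  (forall x, x \in s ++ t -> flow x) -> size s = size t -> total s = total t ->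
  cong s t.
Proof.
elim: t s => [|g t IHt] s fst; first by move/size0nil-> => _; apply: cong_refl.
have fg : flow g by apply: fst; rewrite mem_cat mem_head orbT.
case: s fst => [|f [|f' s]] fst //= [st].
  by move=> tE; apply: cong_small => //=; rewrite -st.
move=> tE.
have ft x : x \in t -> flow x.
  by move=> xt; apply: fst; rewrite mem_cat !inE xt !orbT.
have bound e : (size s).+1%:Z * lo e <= (f + total (f' :: s) - g) e
                 <= (size s).+1%:Z * hi e.
  have -> : f + total (f' :: s) - g = total t.
    by rewrite -total_cons tE total_cons addrC addKr.
  by rewrite st total_le ?total_ge // => x /ft[/(_ e)/andP[]].
have mem x : x \in [:: f, f' & s] -> flow x.
  by move=> xs; apply: fst; rewrite mem_cat xs.
have [ff ff'] : flow f /\ flow f' by split; apply: mem; rewrite !inE eqxx ?orbT.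
have [|v|v|x xs|s' [fs' ss' ts' cs']] :=
  @walk (absz (\sum_e `|(g - f) e|)).+1 g f f' s v0 v0 f f' _ fg ff ff' erefl
    ff.1 ff'.1 _ _ _ bound.
- have : 0 <= \sum_e `|(g - f) e| by rewrite sumr_ge0.
  lia.
- by rewrite ff.2 addrK.
- by rewrite ff'.2 subrK.
- by apply: mem; rewrite !inE xs !orbT.
apply: cong_trans cs' _.
apply: (@cong_cat [:: g] s' [:: g] t); first exact: cong_refl.
apply: IHt; last first.
- by apply: (addrI g); rewrite ts' -(total_cons g t) -tE !total_cons addrA.
- by rewrite ss'.
- by move=> x; rewrite mem_cat => /orP[/fs'|/ft].
Qed.

End Netflow.

(** * Generators of the toric ideal *)

Section ToricGeneration.
Context (R : realType) (I : finType) (k : fieldType) (P : set {ffun I -> R}).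
Local Notation A := (lattice_points P).
Local Notation binom m m' :=
  (mkmalgU m 1 - mkmalgU m' 1 : {malg k[{cmonom A}]}).

Definition low_degree q : set {malg k[{cmonom A}]} :=
  [set p | toric_ideal k P p /\ (msize p <= q.+1)%N].

Lemma generated_low_degree q :
  (forall m m' : {cmonom A}, weight m = weight m' ->
     ideal_span (low_degree q) (binom m m')) ->
  generated_in_degree q (toric_ideal k P).
Proof.
move=> bin; exists (low_degree q); split=> [g []//|].
apply/seteqP; split=> [p|p [n [h [g [Gg ->]]]]].
  exact: toric_binomials bin.
rewrite /toric_ideal /= rmorph_sum big1 // => i _.
by rewrite rmorphM; have [/= -> _] := Gg i; rewrite mulr0.
Qed.

Definition lift (s : seq {ffun I -> int}) : seq A := pmap insub s.

Lemma lift_val (s : seq A) : lift (map val s) = s.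
Proof. exact: (map_pK valK). Qed.

Lemma val_lift s : (forall x, x \in s -> A x) -> map val (lift s) = s.
Proof.
move=> sA; rewrite /lift (pmap_filter (insubK _)).
apply/all_filterP/allP => x xs.
by rewrite isSome_insub; apply/mem_set/sA.
Qed.

Definition toric_cong q s t :=
  ideal_span (low_degree q) (binom (monom_of (lift s)) (monom_of (lift t))).

Lemma toric_cong_perm q s t : perm_eq s t -> toric_cong q s t.
Proof.
move=> st; rewrite /toric_cong (perm_monom_of (perm_pmap _ st)) subrr.
exact: ideal_span0.
Qed.

Lemma toric_cong_trans q s t r :
  toric_cong q s t -> toric_cong q t r -> toric_cong q s r.
Proof.
move=> st tr; have := ideal_spanD st tr.
by rewrite addrA subrK.
Qed.

Lemma toric_cong_cat q s s' t t' :
  toric_cong q s t -> toric_cong q s' t' -> toric_cong q (s ++ s') (t ++ t').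
Proof.
rewrite /toric_cong /lift !pmap_cat !monom_of_cat -!malgUM.
exact: ideal_span_mulB.
Qed.

Lemma toric_cong_small q s t :
  (forall x, x \in s ++ t -> A x) -> (size s <= q)%N -> size s = size t ->
  \sum_(x <- s) x = \sum_(x <- t) x -> toric_cong q s t.
Proof.
move=> stA sq st sum_st; apply: ideal_span_gen.
have sE : map val (lift s) = s.
  by apply: val_lift => x xs; apply: stA; rewrite mem_cat xs.
have tE : map val (lift t) = t.
  by apply: val_lift => x xt; apply: stA; rewrite mem_cat xt orbT.
split.
  apply: toric_hom_binomial; rewrite !weight_monom_of.
  by rewrite -!(big_map val xpredT id) sE tE sum_st.
apply: msize_binomial; rewrite mdeg_monom_of -(size_map val).
  by rewrite sE.
by rewrite tE -st.
Qed.

End ToricGeneration.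

Section FlowPolytope.
Context (R : realType) (V : finType) (E : {set V * V}).
Context (d : {ffun V -> int}) (u l : {ffun {e | e \in E} -> int}).
Local Notation src := (fun e : {e | e \in E} => (val e).1).
Local Notation dst := (fun e : {e | e \in E} => (val e).2).

Lemma flow_lattice_points a :
  lattice_points (flow_polytope R d u l) a <->
  flow src dst (fun e => Num.max 0 (l e)) u d a.
Proof.
rewrite /lattice_points /flow_polytope /=; split=> [[a0 ad al]|[ab ad]].
  split=> [e|v].
    have := al e; have := a0 e.
    rewrite !ffunE ler0z !ler_int => ae /andP[le ue].
    by rewrite ge_max ae le ue.
  apply: (@intr_inj R); rewrite -(ad v) netflowE rmorphB !rmorph_sum /=.
  by congr (_ - _); apply: eq_bigr => e _; rewrite ffunE.
split=> [e|v|e].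
- by rewrite ffunE ler0z; have := ab e; rewrite ge_max => /andP[/andP[]].
- rewrite -(ad v) netflowE rmorphB !rmorph_sum /=.
  by congr (_ - _); apply: eq_bigr => e _; rewrite ffunE.
- by rewrite ffunE !ler_int; have := ab e; rewrite ge_max => /andP[/andP[_ ->]].
Qed.

End FlowPolytope.

Theorem mainTheorem1 (R : realType) (k : fieldType) (V : finType)
    (E : {set V * V}) (d : {ffun V -> int}) (hd : d <> 0)
    (u l : {ffun {e | e \in E} -> int}) :
  generated_in_degree 3 (toric_ideal k (flow_polytope R d u l)).
Proof.
have [v dv] : exists v, d v <> 0.
  apply/existsNP => d0; apply/hd/ffunP => v; rewrite ffunE.
  exact: d0.
apply: generated_low_degree => m m'.
have [s ->] := monom_ofP m; have [t ->] := monom_ofP m'.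
rewrite !weight_monom_of -!(big_map val xpredT id).
have sumd (r : seq (lattice_points (flow_polytope R d u l))) :
    netflow (fun e => (val e).1) (fun e => (val e).2) (total (map val r)) v
      = d v *+ size r.
  elim: r => [|a r IHr]; first by rewrite /total big_nil netflow0.
  rewrite /= total_cons netflowD IHr mulrS; congr (_ + _).
  by have /set_mem/flow_lattice_points[_] := valP a; apply.
move=> tE; rewrite -(lift_val s) -(lift_val t).
apply: (cong_total (lo := fun e => Num.max 0 (l e)) (hi := u) (d := d)
  (cong := @toric_cong R _ k _ 3) _ _ _ _ v (s := map val s)).
- exact: toric_cong_trans.
- exact: toric_cong_perm.
- exact: toric_cong_cat.
- move=> s' t' st sz szt tot; apply: toric_cong_small => // x /st.
  by move/flow_lattice_points.
- move=> x; rewrite -map_cat => /mapP[a _ ->].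
  by apply/flow_lattice_points/set_mem/valP.
- rewrite !size_map; have := sumd s; rewrite {1}/total tE -/(total _) sumd.
  move/eqP; rewrite -!(mulr_natr (d v)) => /eqP/(mulfI (introN eqP dv)).
  by move/eqP; rewrite eqr_nat => /eqP.
- exact: tE.
Qed.
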